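(* Let $\rho$ be a quantum state on a complex Hilbert space $\mathcal{H}$ of finite dimension $d$. The maximal amount of secret randomness that can be extracted from $\rho$ using a projective measurement is $$H^*_{\min}=-\log_2 P^*_{\mathrm{guess}}(\rho),\qquad P^*_{\mathrm{guess}}(\rho)=\frac{1}{d}\left(\operatorname{tr}\sqrt{\rho}\right)^2 .$$ That is, the minimum of $P_{\mathrm{guess}}(\rho,\mathcal{M})$ over all projective measurements $\mathcal{M}$ on $\mathcal{H}$ equals $\frac1d(\operatorname{tr}\sqrt\rho)^2$.
   Context: A quantum state (density operator) on $\mathcal{H}$ is a positive semidefinite operator $\rho$ with $\operatorname{tr}\rho=1$. A projective measurement on $\mathcal{H}$ is a finite family $\mathcal{M}=\{M_i\}_i$ of positive semidefinite operators with $M_iM_j=\delta_{ij}M_i$ and $\sum_i M_i=\mathbb{1}$ (the projectors $M_i$ may have any rank). For a state $\rho$ and a measurement $\mathcal{M}=\{M_i\}_i$, the (adversary's optimal) guessing probability is $$P_{\mathrm{guess}}(\rho,\mathcal{M})=\max_{\{\rho_i\}_i}\ \sum_i\operatorname{tr}(M_i\rho_i),$$ the maximum being over families of operators indexed like $\mathcal{M}$ with $\rho_i\ge 0$ for all $i$ and $\sum_i\rho_i=\rho$. Define $$P^*_{\mathrm{guess}}(\rho)=\min_{\mathcal{M}\in\Pi}P_{\mathrm{guess}}(\rho,\mathcal{M}),$$ where $\Pi$ is the set of all projective measurements on $\mathcal{H}$. The maximal amount of secret randomness (conditional min-entropy) extractable from $\rho$ by projective measurements is $H^*_{\min}=-\log_2P^*_{\mathrm{guess}}(\rho)$.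 $\sqrt\rho$ is the positive semidefinite square root. *)

(* Defs.v *)
(* Operators on H = C^d are d x d matrices over C = R[i],
   written in an orthonormal basis, and vectors are columns. *)
From mathcomp Require Import all_boot all_order all_algebra.
From mathcomp Require Import complex.
From mathcomp Require Import all_classical all_reals all_analysis.

Set Implicit Arguments.
Unset Strict Implicit.
Unset Printing Implicit Defensive.

Import Order.TTheory GRing.Theory Num.Theory.
Local Open Scope classical_set_scope.
Local Open Scope ring_scope.
Local Open Scope complex_scope.
Local Open Scope sesquilinear_scope.

Section Psd.
Variable C : numClosedFieldType.

(* In the partial order of C, 0 <= z means that z is real and nonnegative, so
   the quadratic-form condition alone already forces A to be Hermitian when C
   is R[i]; hermiticity is nevertheless kept explicit. *)
Definition psdmx n (A : 'M[C]_n) : Prop :=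
  A \is hermsymmx /\ forall v : 'cV[C]_n, 0 <= (v^t* *m A *m v) 0 0.

(* The positive semidefinite square root; sqrtmxP and psd_sqrt_uniq show that
   it exists and is unique for psd A (the default value 0 is then unused). *)
Definition sqrtmx n (A : 'M[C]_n) : 'M[C]_n :=
  xget 0 [set S | psdmx S /\ S *m S = A].

Lemma psd_conj n (A P : 'M[C]_n) : psdmx A -> psdmx (P *m A *m P^t*).
Proof.
move=> [/is_hermitianmxP]; rewrite expr0 scale1r => hA pA; split.
  apply/is_hermitianmxP; rewrite expr0 scale1r !trmx_mul !map_mxM.
  by rewrite trmxCK -hA mulmxA.
move=> v; have := pA (P^t* *m v).
by rewrite trmx_mul map_mxM trmxCK !mulmxA.
Qed.

Lemma psd_diag_ge0 n (A : 'M[C]_n) i : psdmx A -> 0 <= A i i.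
Proof.
move=> [_ /(_ (delta_mx i 0))].
rewrite -mulmxA -colE trmx_delta map_delta_mx -rowE.
by rewrite !mxE.
Qed.

Lemma spectralE n (A : 'M[C]_n) : A \is hermsymmx ->
  A = (spectralmx A)^t* *m diag_mx (spectral_diag A) *m spectralmx A.
Proof.
move=> /hermitian_normalmx /orthomx_spectralP {1}->.
by rewrite invmx_unitary // spectral_unitarymx.
Qed.

Lemma sqrtmxP n (A : 'M[C]_n) : psdmx A ->
  psdmx (sqrtmx A) /\ sqrtmx A *m sqrtmx A = A.
Proof.
move=> pA; rewrite /sqrtmx; case: xgetP => [S _ []//|].
have [hA _] := pA.
set P := spectralmx A; set D := spectral_diag A.
have EA : A = P^t* *m diag_mx D *m P by exact: spectralE.
have PP : P *m P^t* = 1%:M by apply/unitarymxP/spectral_unitarymx.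
have D0 i : 0 <= D 0 i.
  have := psd_diag_ge0 i (psd_conj P pA).
  rewrite {1}EA !mulmxA PP mul1mx -mulmxA PP mulmx1.
  by rewrite mxE eqxx mulr1n.
pose E := diag_mx (map_mx sqrtC D).
have pE : psdmx E.
  split.
    apply/is_hermitianmxP; rewrite expr0 scale1r.
    apply/matrixP => i j; rewrite !mxE eq_sym.
    case: eqVneq => [->|]; last by rewrite !mulr0n conjC0.
    by rewrite !mulr1n geC0_conj // sqrtC_ge0.
  move=> v; rewrite mul_mx_diag mxE sumr_ge0 // => i _.
  rewrite !mxE mulrAC mulr_ge0 ?sqrtC_ge0 //.
  by rewrite mulrC mul_conjC_ge0.
move=> /(_ (P^t* *m E *m P)) []; split.
  by have := psd_conj (P^t*) pE; rewrite trmxCK.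
have EE : E *m E = diag_mx D.
  rewrite mulmx_diag; congr diag_mx.
  by apply/rowP => i; rewrite !mxE -expr2 sqrtCK.
by rewrite -!mulmxA (mulmxA P) PP mul1mx (mulmxA E) EE [RHS]EA mulmxA.
Qed.

Lemma psd_sqrt_uniq n (S T : 'M[C]_n) : psdmx S -> psdmx T ->
  S *m S = T *m T -> S = T.
Proof.
move=> pS pT eST.
have hD : S - T \is hermsymmx.
  have [/is_hermitianmxP] := pS; rewrite expr0 scale1r => hS _.
  have [/is_hermitianmxP] := pT; rewrite expr0 scale1r => hT _.
  apply/is_hermitianmxP; rewrite expr0 scale1r.
  by rewrite linearB /= map_mxB -hS -hT.
apply/eqP; rewrite -subr_eq0; apply/eqP.
rewrite (spectralE hD); set P := spectralmx _; set D := spectral_diag _.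
have PP : P *m P^t* = 1%:M by apply/unitarymxP/spectral_unitarymx.
have ED : P *m (S - T) *m P^t* = diag_mx D.
  by rewrite {1}(spectralE hD) !mulmxA PP mul1mx -mulmxA PP mulmx1.
have P'P : P^t* *m P = 1%:M by apply: mulmx1C.
pose S' := P *m S *m P^t*; pose T' := P *m T *m P^t*.
have sqE (X : 'M[C]_n) :
    (P *m X *m P^t*) *m (P *m X *m P^t*) = P *m (X *m X) *m P^t*.
  by rewrite -!mulmxA (mulmxA (P^t*)) P'P mul1mx.
have E1 : S' - T' = diag_mx D by rewrite -ED mulmxBr mulmxBl.
have E2 : S' *m diag_mx D + diag_mx D *m T' = 0.
  rewrite -E1 mulmxBr mulmxBl addrA subrK.
  by rewrite /S' /T' !sqE eST subrr.
suff -> : D = 0 by rewrite raddf0 mulmx0 mul0mx.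
apply/rowP => i; rewrite [RHS]mxE.
have S0 : 0 <= S' i i by apply/psd_diag_ge0/psd_conj.
have T0 : 0 <= T' i i by apply/psd_diag_ge0/psd_conj.
have := congr1 (fun X : 'M[C]_n => X i i) E2.
rewrite mul_mx_diag mul_diag_mx [LHS]mxE [X in X + _]mxE [X in _ + X]mxE.
rewrite [RHS]mxE [X in X + _]mulrC -mulrDr => /eqP.
rewrite mulf_eq0 => /orP[/eqP //|].
rewrite paddr_eq0 // => /andP[/eqP s0 /eqP t0].
have := congr1 (fun X : 'M[C]_n => X i i) E1.
rewrite [LHS]mxE [X in _ + X]mxE s0 t0 subrr => d0.
by move: d0; rewrite mxE eqxx mulr1n => <-.
Qed.

Lemma tr_psd_mul_ge0 n (A B : 'M[C]_n) : psdmx A -> psdmx B ->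
  0 <= \tr (A *m B).
Proof.
move=> /sqrtmxP[pS <-] pB; have [/is_hermitianmxP] := pS.
rewrite expr0 scale1r => hS _.
rewrite -mulmxA mxtrace_mulC {2}hS sumr_ge0 // => i _.
exact/psd_diag_ge0/psd_conj.
Qed.

End Psd.

Section Guessing.
Variable R : realType.
Local Notation C := R[i].

Definition quantum_state d (rho : 'M[C]_d) : Prop :=
  psdmx rho /\ \tr rho = 1.

Definition projective_measurement d (I : finType) (M : I -> 'M[C]_d) : Prop :=
  [/\ forall i, psdmx (M i),
      forall i j, M i *m M j = (i == j)%:R *: M i &
      \sum_i M i = 1%:M].

Definition state_decomposition d (I : finType) (rho : 'M[C]_d)
    (r : I -> 'M[C]_d) : Prop :=
  (forall i, psdmx (r i)) /\ \sum_i r i = rho.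

(* By tr_psd_mul_ge0 the sum of traces is real, so requiring it to be of the
   form p%:C excludes no decomposition. *)
Definition guess_values d (I : finType) (rho : 'M[C]_d) (M : I -> 'M[C]_d) :
    set R :=
  [set p | exists2 r : I -> 'M[C]_d, state_decomposition rho r &
                                     p%:C = \sum_i \tr (M i *m r i)].

Definition is_maximum (A : set R) (m : R) : Prop := A m /\ ubound A m.
Definition is_minimum (A : set R) (m : R) : Prop := A m /\ lbound A m.

(* sup and inf are total stand-ins for max and min; that they are attained has
   to be asserted separately, with is_maximum and is_minimum. *)
Definition Pguess d (I : finType) (rho : 'M[C]_d) (M : I -> 'M[C]_d) : R :=
  sup (guess_values rho M).

Definition Pguess_values d (rho : 'M[C]_d) : set R :=
  [set p | exists (I : finType) (M : I -> 'M[C]_d),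
             projective_measurement M /\ p = Pguess rho M].

Definition Pguess_star d (rho : 'M[C]_d) : R := inf (Pguess_values rho).

Definition log2 (x : R) : R := ln x / ln 2.

Definition Hmin_star d (rho : 'M[C]_d) : R := - log2 (Pguess_star rho).

End Guessing.

(* Main.v *)
(* Put S = sqrt rho. Against any measurement M the adversary may use
   rho_i = S M_i S; its value is tr X^2, where X = sum_i M_i S M_i has trace
   tr S, and tr X^2 >= (tr X)^2 / d by Cauchy-Schwarz. Conversely, for M_i the
   rank-one projectors on a basis unbiased to an eigenbasis of S (its Fourier
   transform), weighted Cauchy-Schwarz in the eigenbasis gives
   tr (M_i A) <= (tr S / d) tr (S^-1 A) for the parts A of rho (S^-1 being
   taken on the support of rho), which sums to at most (tr S)^2 / d. The
   adversary's maximum is attained because the decompositions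
   rho = sum_i X_i^* X_i form a closed subset of a cube. *)
Require Import Defs.
From mathcomp Require Import all_boot all_order all_algebra.
From mathcomp Require Import cyclic separable cyclotomic.
From mathcomp Require Import complex.
From mathcomp Require Import ring.
From mathcomp Require Import all_classical all_reals all_analysis.
Local Open Scope ring_scope.

Set Implicit Arguments.
Unset Strict Implicit.
Unset Printing Implicit Defensive.

Import Order.TTheory GRing.Theory Num.Theory.

(** * Gram factorizations and a trace form of Cauchy-Schwarz *)

Section Psd.
Local Open Scope sesquilinear_scope.
Variable C : numClosedFieldType.

Lemma adjmx_mul m n p (A : 'M[C]_(m, n)) (B : 'M[C]_(n, p)) :
  (A *m B)^t* = B^t* *m A^t*.
Proof. by rewrite trmx_mul map_mxM. Qed.

Lemma psd_adj n (A : 'M[C]_n) : psdmx A -> A^t* = A.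
Proof. by case=> /is_hermitianmxP; rewrite expr0 scale1r => <-. Qed.

Lemma gram_diagE m n (X : 'M[C]_(m, n)) k :
  (X^t* *m X) k k = \sum_l `|X l k| ^+ 2.
Proof.
by rewrite mxE; apply: eq_bigr => l _; rewrite !mxE normCK mulrC.
Qed.

Lemma psd_gram m n (X : 'M[C]_(m, n)) : psdmx (X^t* *m X).
Proof.
split; first by apply/is_hermitianmxP; rewrite expr0 scale1r adjmx_mul trmxCK.
move=> v; rewrite mulmxA -adjmx_mul -mulmxA gram_diagE.
by rewrite sumr_ge0 // => l _; rewrite exprn_ge0.
Qed.

Lemma psd_gramP n (A : 'M[C]_n) : psdmx A -> exists X : 'M[C]_n, A = X^t* *m X.
Proof.
by move=> /sqrtmxP[pS SS]; exists (sqrtmx A); rewrite (psd_adj pS) SS.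
Qed.

Lemma psd_trace_ge0 n (A : 'M[C]_n) : psdmx A -> 0 <= \tr A.
Proof. by move=> pA; rewrite sumr_ge0 // => i _; apply: psd_diag_ge0. Qed.

(** Subtracting the real scalar [c = \tr X / n] keeps [X] Hermitian, so the square of the difference
    has nonnegative trace, namely [\tr (X *m X) - c * \tr X]. *)
Lemma trace_sqr_le n (X : 'M[C]_n) : X^t* = X -> 0 <= \tr X ->
  (\tr X) ^+ 2 / n%:R <= \tr (X *m X).
Proof.
move=> hX t_ge0; case: n X hX t_ge0 => [|n] X hX t_ge0.
  by rewrite invr0 mulr0 /mxtrace big_ord0.
set t := \tr X in t_ge0 *.
pose c := t / n.+1%:R.
have c_ge0 : 0 <= c by rewrite divr_ge0.
have hY : (X - c%:M)^t* = X - c%:M.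
  by rewrite linearB /= map_mxB hX tr_scalar_mx map_scalar_mx /= geC0_conj.
have := psd_trace_ge0 (psd_gram (X - c%:M)).
rewrite hY mulmxBl !mulmxBr mul_scalar_mx mul_mx_scalar -scalar_mxM.
rewrite !(linearB, linearZ) /= mxtrace_scalar -/t.
have -> : c * c *+ n.+1 = c * t.
  by rewrite -mulr_natr -mulrA /c divfK // pnatr_eq0.
rewrite subrr subr0 subr_ge0; congr (_ <= _).
by rewrite /c expr2 mulrAC.
Qed.

End Psd.

(** * The weighted Cauchy-Schwarz inequality *)

Section CauchySchwarz.
Variable F : numFieldType.

(* Since x / 0 = 0, the terms with zero weight contribute nothing on the
   right, hence the condition on [a]. *)
Lemma weighted_cauchy_schwarz (I : finType) (a s : I -> F) :
    (forall k, 0 <= a k) -> (forall k, 0 <= s k) ->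
    (forall k, s k = 0 -> a k = 0) ->
  (\sum_k a k) ^+ 2 <= (\sum_k s k) * \sum_k a k ^+ 2 / s k.
Proof.
move=> a_ge0 s_ge0 as0; set A := \sum_k a k; set T := \sum_k s k.
have T_ge0 : 0 <= T by rewrite sumr_ge0.
have A_ge0 : 0 <= A by rewrite sumr_ge0.
have [T0|Tn0] := eqVneq T 0.
  have s0 k : s k = 0 by apply: (psumr_eq0P _ T0).
  by rewrite T0 mul0r /A big1 ?expr0n // => k _; apply: as0.
have T_gt0 : 0 < T by rewrite lt_def Tn0.
suff : 0 <= \sum_k a k ^+ 2 / s k - A ^+ 2 / T.
  by rewrite subr_ge0 ler_pdivrMr // mulrC.
(* The gap is a weighted variance, the sum of [s k * (a k / s k - A / T) ^+ 2], where [A / T] is the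
   weighted mean of the ratios. *)
have -> : A ^+ 2 / T = \sum_k (2 * (A / T) * a k - (A / T) ^+ 2 * s k).
  by rewrite sumrB -!mulr_sumr -/A -/T; field.
rewrite -sumrB sumr_ge0 // => k _.
have [sk0|skn0] := eqVneq (s k) 0.
  by rewrite sk0 (as0 _ sk0) expr0n !(mulr0, mul0r) !subr0.
have -> : a k ^+ 2 / s k - (2 * (A / T) * a k - (A / T) ^+ 2 * s k) =
    (a k / s k - A / T) ^+ 2 * s k by field; apply/andP.
by rewrite mulr_ge0 // real_exprn_even_ge0 // rpredB // ger0_real // divr_ge0.
Qed.

End CauchySchwarz.

(** * Flat unitary matrices and quadratic forms at flat vectors *)

Section Unbiased.
Local Open Scope sesquilinear_scope.
Variable C : numClosedFieldType.

(** The polynomial [X^n - 1] splits and is separable, so it has [n] distinct roots, enough to force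
    a primitive one. *)
Lemma prim_root_exists n : (0 < n)%N -> exists z : C, n.-primitive_root z.
Proof.
pose p : {poly C} := 'X^n - 1; have [r Dp] := closed_field_poly_normal p.
move=> n_gt0; rewrite (monicP _) ?monicXnsubC // scale1r in Dp.
have rn1 : all n.-unity_root r.
  by apply/allP=> z; rewrite -root_prod_XsubC -Dp.
have sz_r : (n < (size r).+1)%N.
  by rewrite -(size_prod_XsubC r id) -Dp size_XnsubC.
have [|z] := hasP (has_prim_root n_gt0 rn1 _ sz_r); last by exists z.
by rewrite -separable_prod_XsubC -Dp separable_Xn_sub_1 // pnatr_eq0 -lt0n.
Qed.

(* The witness is the discrete Fourier transform. *)
Lemma flat_unitary_exists d : exists2 F : 'M[C]_d,
  F \is unitarymx & forall i k, `|F i k| ^+ 2 = d%:R^-1.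
Proof.
case: d => [|d].
  by exists 0 => [|[]//]; apply/unitarymxP/matrixP => -[].
have [z zP] := prim_root_exists (ltn0Sn d).
set n := d.+1 in zP *.
have nC0 : n%:R != 0 :> C by rewrite pnatr_eq0.
have z1 : `|z| = 1.
  have /eqP : `|z| ^+ n = 1 by rewrite -normrX (prim_expr_order zP) normr1.
  by rewrite pexpr_eq1 // => /eqP.
have z0 : z != 0 by rewrite -normr_eq0 z1 oner_eq0.
have zJ m : (z ^+ m)^* = z ^- m.
  by rewrite rmorphXn /= -exprVn invC_norm z1 expr1n invr1 mul1r.
pose F : 'M[C]_n := \matrix_(i, k) (z ^+ (i * k) / sqrtC n%:R).
have sqn : sqrtC n%:R * (sqrtC n%:R)^* = n%:R :> C.
  by rewrite geC0_conj ?sqrtC_ge0 ?ler0n // -expr2 sqrtCK.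
exists F => [|i k]; last first.
  by rewrite mxE normrM normrX z1 expr1n mul1r normfV exprVn normCK sqn.
apply/unitarymxP/matrixP => i j; rewrite !mxE.
pose w := z ^+ i / z ^+ j.
have -> : \sum_k F i k * (F^t*) k j = (\sum_(k < n) w ^+ k) / n%:R.
  rewrite mulr_suml; apply: eq_bigr => k _.
  rewrite !mxE rmorphM /= zJ fmorphV mulrACA -invfM sqn.
  by rewrite expr_div_n -!exprM.
have [ij|ij] := eqVneq i j.
  rewrite (eq_bigr (fun=> 1)) => [|k _]; last first.
    by rewrite /w ij divff ?expf_neq0 // expr1n.
  by rewrite sumr_const card_ord divff.
(* Off the diagonal, [w] is an [n]-th root of unity other than 1, because [i] and [j] are below [n];
   its geometric sum therefore vanishes. *)
have w1 : w != 1.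
  apply: contra ij => /eqP /(congr1 ( *%R^~ (z ^+ j))).
  rewrite /w divfK ?expf_neq0 // mul1r => /eqP.
  by rewrite (eq_prim_root_expr zP) /= !modn_small // => /eqP/val_inj->.
have : (w - 1) * \sum_(k < n) w ^+ k = 0.
  rewrite -subrX1 /w expr_div_n -!exprM ![(_ * n)%N]mulnC !exprM.
  by rewrite (prim_expr_order zP) !expr1n divr1 subrr.
move/eqP; rewrite mulf_eq0 subr_eq0 (negPf w1) /= => /eqP ->.
by rewrite mul0r.
Qed.

(** With [A = X^t* *m X], the form is a sum of squared moduli over the rows of [X]. Weighted
    Cauchy-Schwarz bounds each one, and the flatness of [f] supplies the factor [1 / d]. *)
Lemma quad_form_le d (f : 'cV[C]_d) (s : 'I_d -> C) (A : 'M[C]_d) :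
    psdmx A -> (forall k, 0 <= s k) -> (forall k, s k = 0 -> A k k = 0) ->
    (forall k, `|f k 0| ^+ 2 = d%:R^-1) ->
  (f^t* *m A *m f) 0 0 <= (\sum_k s k) / d%:R * \sum_k A k k / s k.
Proof.
move=> /psd_gramP[X ->] s_ge0 As0 fE.
rewrite mulmxA -adjmx_mul -mulmxA gram_diagE.
have -> : (\sum_k s k) / d%:R * (\sum_k (X^t* *m X) k k / s k) =
    \sum_l (\sum_k s k) * \sum_k (`|X l k| * `|f k 0|) ^+ 2 / s k.
  rewrite -mulr_sumr exchange_big /= -mulrA; congr (_ * _).
  rewrite mulr_sumr; apply: eq_bigr => k _.
  rewrite gram_diagE -[RHS]mulr_suml mulrA; congr (_ / _).
  by rewrite mulr_sumr; apply: eq_bigr => l _; rewrite exprMn fE mulrC.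
apply: ler_sum => l _.
apply: (@le_trans _ _ ((\sum_k `|X l k| * `|f k 0|) ^+ 2)).
  apply: lerXn2r; rewrite ?nnegrE //.
    by rewrite sumr_ge0 // => k _; rewrite mulr_ge0.
  rewrite mxE (le_trans (ler_norm_sum _ _ _)) //.
  by apply: ler_sum => k _; rewrite normrM.
(* Where [s k] vanishes, so does [A k k], the squared norm of column [k] of [X]. *)
apply: weighted_cauchy_schwarz => // k /As0.
rewrite gram_diagE => /psumr_eq0P Xk0.
have /eqP : `|X l k| ^+ 2 = 0 by apply: Xk0 => // m _; rewrite exprn_ge0.
by rewrite expf_eq0 /= => /eqP ->; rewrite mul0r.
Qed.

End Unbiased.

Local Open Scope complex_scope.

(** * Upper bound from an unbiased basis, lower bound from pinching *)

Section Measurement.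
Local Open Scope sesquilinear_scope.
Variable R : realType.
Local Notation C := R[i].

Lemma rank_one_measurement d (U : 'M[C]_d) : U \is unitarymx ->
  projective_measurement (fun i => (row i U)^t* *m row i U).
Proof.
move=> /unitarymxP UU; split=> [i|i j|].
- exact: psd_gram.
- have Uij : row i U *m (row j U)^t* = (i == j)%:R%:M.
    have := congr1 (fun A : 'M[C]_d => A i j) UU; rewrite !mxE => E.
    apply/matrixP => a b; rewrite !ord1 !mxE mulr1n -[RHS]E.
    by apply: eq_bigr => k _; rewrite !mxE.
  rewrite mulmxA -(mulmxA _ (row i U)) Uij mul_mx_scalar -scalemxAl.
  by have [->//|_] := eqVneq i j; rewrite !scale0r.
- rewrite -[RHS](mulmx1C UU); apply/matrixP => a b.
  rewrite summxE mxE; apply: eq_bigr => i _.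
  by rewrite mxE big_ord1 !mxE.
Qed.

Lemma unbiased_measurement_le d (rho : 'M[C]_d) : psdmx rho ->
  exists2 M : 'I_d -> 'M[C]_d, projective_measurement M &
    forall r, state_decomposition rho r ->
      \sum_i \tr (M i *m r i) <= (\tr (sqrtmx rho)) ^+ 2 / d%:R.
Proof.
move=> prho; have [pS SS] := sqrtmxP prho; set S := sqrtmx rho in pS SS *.
have ES := spectralE pS.1.
set P := spectralmx S in ES; set D := spectral_diag S in ES.
have uP : P \is unitarymx by apply: spectral_unitarymx.
have PP : P *m P^t* = 1%:M by apply/unitarymxP.
have DE : P *m S *m P^t* = diag_mx D.
  by rewrite ES !mulmxA PP mul1mx -mulmxA PP mulmx1.
pose s k : C := D 0 k.
have s_ge0 k : 0 <= s k.
  by have := psd_diag_ge0 k (psd_conj P pS); rewrite DE mxE eqxx mulr1n.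
have rhoE k : (P *m rho *m P^t*) k k = s k ^+ 2.
  have -> : P *m rho *m P^t* = diag_mx D *m diag_mx D.
    rewrite -DE -SS -!mulmxA (mulmxA (P^t*)) (mulmx1C PP) mul1mx.
    by rewrite !mulmxA.
  by rewrite mulmx_diag !mxE eqxx mulr1n expr2.
have trS : \tr S = \sum_k s k.
  by rewrite ES -mulmxA mxtrace_mulC -mulmxA PP mulmx1 mxtrace_diag.
have [F uF FE] := flat_unitary_exists C d.
(* In the basis [P] that diagonalizes [S], the rows of [F *m P] have coordinates of squared modulus
   [1 / d]. *)
exists (fun i => (row i (F *m P))^t* *m row i (F *m P)).
  exact/rank_one_measurement/mul_unitarymx.
move=> r [pr rE].
have sum_diag k : \sum_i (P *m r i *m P^t*) k k = s k ^+ 2.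
  by rewrite -rhoE -rE mulmx_sumr mulmx_suml summxE.
have diag_ge0 i k : 0 <= (P *m r i *m P^t*) k k.
  exact/psd_diag_ge0/psd_conj.
(* In the eigenbasis of S this is the dual certificate
   M_i <= (tr S / d) S^-1, whose pairing with rho is (tr S)^2 / d. *)
have le_i i : \tr ((row i (F *m P))^t* *m row i (F *m P) *m r i) <=
    \tr S / d%:R * \sum_k (P *m r i *m P^t*) k k / s k.
  set f := (row i F)^t*.
  have -> : \tr ((row i (F *m P))^t* *m row i (F *m P) *m r i) =
      (f^t* *m (P *m r i *m P^t*) *m f) 0 0.
    rewrite -mulmxA mxtrace_mulC row_mul adjmx_mul -/f /f trmxCK !mulmxA.
    by rewrite /mxtrace big_ord1.
  rewrite trS.
  apply: quad_form_le => // [|k sk0|k].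
  - exact: psd_conj.
  (* Nonnegative entries summing to [s k ^+ 2 = 0]: no part has weight outside the support of
     [rho]. *)
  - have := sum_diag k; rewrite sk0 expr0n => /psumr_eq0P -> //.
  - by rewrite !mxE norm_conjC FE.
apply: (le_trans (ler_sum _ (fun i _ => le_i i))).
rewrite -mulr_sumr exchange_big /= expr2 [leRHS]mulrAC; apply: ler_wpM2l.
  by rewrite divr_ge0 ?ler0n // psd_trace_ge0.
rewrite trS; apply: ler_sum => k _; rewrite -mulr_suml sum_diag expr2.
(* Each term is [s k ^+ 2 / s k = s k], even at [s k = 0], since [x / 0 = 0]. *)
by have [->|s0] := eqVneq (s k) 0; rewrite ?mul0r // mulfK.
Qed.

Lemma pinched_decomposition d (I : finType) (rho : 'M[C]_d)
    (M : I -> 'M[C]_d) : psdmx rho -> projective_measurement M ->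
  state_decomposition rho (fun i => sqrtmx rho *m M i *m sqrtmx rho).
Proof.
move=> /sqrtmxP[pS SS] [pM _ M1]; split=> [i|].
  by rewrite -{2}(psd_adj pS); apply: psd_conj.
by rewrite -mulmx_suml -mulmx_sumr M1 mulmx1.
Qed.

Lemma pinched_decomposition_ge d (I : finType) (rho : 'M[C]_d)
    (M : I -> 'M[C]_d) : psdmx rho -> projective_measurement M ->
  (\tr (sqrtmx rho)) ^+ 2 / d%:R <=
    \sum_i \tr (M i *m (sqrtmx rho *m M i *m sqrtmx rho)).
Proof.
move=> /sqrtmxP[pS _] [pM MM M1]; set S := sqrtmx rho in pS *.
have Mid i : M i *m M i = M i by rewrite MM eqxx scale1r.
(* Pinching preserves the trace of S, and the value of the strategy is the
   trace of the square of the pinched operator. *)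
pose X := \sum_i M i *m S *m M i.
have trX : \tr X = \tr S.
  rewrite -[RHS](congr1 mxtrace (mulmx1 S)) -M1 mulmx_sumr !raddf_sum /=.
  by apply: eq_bigr => i _; rewrite mxtrace_mulC mulmxA Mid mxtrace_mulC.
have hX : X^t* = X.
  rewrite /X raddf_sum /= [LHS]raddf_sum /=; apply: eq_bigr => i _.
  by rewrite !adjmx_mul !(psd_adj pS, psd_adj (pM i)) mulmxA.
rewrite -trX; apply: (le_trans (trace_sqr_le hX _)).
  by rewrite trX psd_trace_ge0.
rewrite /X mulmx_sumr raddf_sum; apply: ler_sum => i _.
(* Orthogonality kills the cross terms of [X *m X]; cyclicity of the trace matches the others with
   the value of the strategy. *)
rewrite mulmx_suml (bigD1 i) //= big1 ?addr0 => [|j ji].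
  have -> : M i *m S *m M i *m (M i *m S *m M i) =
      M i *m S *m M i *m S *m M i.
    by rewrite !mulmxA -(mulmxA _ (M i) (M i)) Mid.
  by rewrite mxtrace_mulC !mulmxA Mid.
rewrite !mulmxA -(mulmxA _ (M j)) MM (negPf ji) scale0r.
by rewrite mulmx0 !mul0mx.
Qed.

End Measurement.

(** * Attainment of the adversary's maximum by compactness *)

Section Attainment.
Local Open Scope sesquilinear_scope.
Local Open Scope classical_set_scope.
Variable R : realType.
Local Notation C := R[i].
Import numFieldNormedType.Exports.

Section ComplexContinuity.
Variable T : topologicalType.

(** Phrased on real and imaginary parts, so that the only topology on values is that of [R]. *)
Definition ccontinuous (f : T -> C) :=
  continuous (fun x => complex.Re (f x) : R) /\
  continuous (fun x => complex.Im (f x) : R).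

Lemma eq_ccontinuous f g : f =1 g -> ccontinuous f -> ccontinuous g.
Proof. by move=> /funext ->. Qed.

Lemma ccontinuous_cst c : ccontinuous (fun=> c).
Proof. by split=> x; apply: cvg_cst. Qed.

Lemma ccontinuousD f g : ccontinuous f -> ccontinuous g ->
  ccontinuous (fun x => f x + g x).
Proof.
move=> [f1 f2] [g1 g2]; split=> x.
- under eq_fun do rewrite raddfD.
  by apply: cvgD; [exact: f1|exact: g1].
- under eq_fun do rewrite raddfD.
  by apply: cvgD; [exact: f2|exact: g2].
Qed.

Lemma ccontinuousM f g : ccontinuous f -> ccontinuous g ->
  ccontinuous (fun x => f x * g x).
Proof.
move=> [f1 f2] [g1 g2]; split=> x.
- rewrite (_ : (fun _ => _) = fun x => complex.Re (f x) * complex.Re (g x) -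
      complex.Im (f x) * complex.Im (g x)); last first.
    by apply/funext => y; case: (f y) (g y) => [? ?] [].
  by apply: cvgB; apply: cvgM; [exact: f1|exact: g1|exact: f2|exact: g2].
- rewrite (_ : (fun _ => _) = fun x => complex.Re (f x) * complex.Im (g x) +
      complex.Im (f x) * complex.Re (g x)); last first.
    by apply/funext => y; case: (f y) (g y) => [? ?] [].
  by apply: cvgD; apply: cvgM; [exact: f1|exact: g2|exact: f2|exact: g1].
Qed.

Lemma ccontinuousJ f : ccontinuous f -> ccontinuous (fun x => (f x)^*).
Proof.
move=> [f1 f2]; split=> x.
- rewrite (_ : (fun _ => _) = fun x => complex.Re (f x)); first exact: f1.
  by apply/funext => y; case: (f y).
- rewrite (_ : (fun _ => _) = fun x => - complex.Im (f x)).
    by apply: cvgN; exact: f2.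
  by apply/funext => y; case: (f y).
Qed.

Lemma ccontinuous_sum (J : finType) (f : J -> T -> C) :
  (forall j, ccontinuous (f j)) -> ccontinuous (fun x => \sum_j f j x).
Proof.
move=> fc; elim: (index_enum J) => [|j s IHs].
  by under eq_fun do rewrite big_nil; exact: ccontinuous_cst.
under eq_fun do rewrite big_cons.
exact: ccontinuousD.
Qed.

Lemma closed_ccontinuous_eq (f : T -> C) (c : C) : ccontinuous f ->
  closed [set x | f x = c].
Proof.
move=> [f1 f2].
rewrite (_ : [set _ | _] = [set x | complex.Re (f x) = complex.Re c] `&`
    [set x | complex.Im (f x) = complex.Im c]); last first.
  apply/seteqP; split=> x /=; first by move->.
  by case: (f x) c => [? ?] [? ?] /= [-> ->].
have closed1 (r : R) : closed [set y : R | y = r] by exact: closed_eq.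
apply: closedI.
- exact: (iffLR (continuous_closedP _) f1 _ (closed1 (complex.Re c))).
- exact: (iffLR (continuous_closedP _) f2 _ (closed1 (complex.Im c))).
Qed.

End ComplexContinuity.

Section Coordinates.
Variables (d : nat) (I : finType).

(** A product of real lines, the form to which Tychonoff's theorem applies; the boolean selects the
    imaginary part. *)
Definition coord_space :=
  prod_topology (fun _ : I * 'I_d * 'I_d * bool => R : topologicalType).

Definition coord_mx (x : coord_space) (i : I) : 'M[C]_d :=
  \matrix_(j, k) (x (i, j, k, false) +i* x (i, j, k, true))%C.

Definition mx_coord (X : I -> 'M[C]_d) : coord_space :=
  fun u => let: (i, j, k, b) := u in
    if b then complex.Im (X i j k) else complex.Re (X i j k).

Lemma mx_coordK X : coord_mx (mx_coord X) = X.
Proof.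
by apply/funext => i; apply/matrixP => j k; rewrite mxE /=; case: (X i j k).
Qed.

Lemma ccontinuous_coord_mx i j k :
  ccontinuous (fun x : coord_space => coord_mx x i j k).
Proof.
split.
- rewrite (_ : (fun _ => _) = proj (i, j, k, false)); last first.
    by apply/funext => x; rewrite mxE.
  exact: proj_continuous.
- rewrite (_ : (fun _ => _) = proj (i, j, k, true)); last first.
    by apply/funext => x; rewrite mxE.
  exact: proj_continuous.
Qed.

Lemma ccontinuous_gram i j k :
  ccontinuous (fun x : coord_space => ((coord_mx x i)^t* *m coord_mx x i) j k).
Proof.
apply: (@eq_ccontinuous _ (fun x => \sum_l
    (coord_mx x i l j)^* * coord_mx x i l k)) => [x|].
  by rewrite [RHS]mxE; apply: eq_bigr => l _; rewrite !mxE.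
apply: ccontinuous_sum => l.
by apply: ccontinuousM; [apply: ccontinuousJ|]; exact: ccontinuous_coord_mx.
Qed.

(* Writing each part as a Gram matrix makes positivity automatic, so that only
   polynomial equations remain to be shown closed. *)
Definition gram_decompositions (rho : 'M[C]_d) : set coord_space :=
  [set x | \sum_i (coord_mx x i)^t* *m coord_mx x i = rho].

(** Continuous equations cut out a closed set, which lies in a cube because the squared moduli of
    all entries sum to [\tr rho = 1]. *)
Lemma compact_gram_decompositions (rho : 'M[C]_d) : quantum_state rho ->
  compact (gram_decompositions rho).
Proof.
move=> [prho trho].
pose box : set coord_space := [set x | forall u, `[-1, 1]%classic (x u)].
have compact_box : compact box.
  apply: (@tychonoff _ (fun=> R : topologicalType)
    (fun=> `[-1, 1]%classic)) => u.
  exact: segment_compact.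
apply: subclosed_compact compact_box _.
  rewrite (_ : gram_decompositions rho = \bigcap_(jk : 'I_d * 'I_d)
      [set x | (\sum_i (coord_mx x i)^t* *m coord_mx x i) jk.1 jk.2 =
        rho jk.1 jk.2]); last first.
    apply/seteqP; split=> [x <- //|x xP]; apply/matrixP => j k.
    exact: (xP (j, k)).
  apply: closed_bigI => -[j k] _; apply: closed_ccontinuous_eq.
  apply: (@eq_ccontinuous _ (fun x => \sum_i
    ((coord_mx x i)^t* *m coord_mx x i) j k)) => [x|].
    by rewrite summxE.
  by apply: ccontinuous_sum => i; apply: ccontinuous_gram.
move=> x xP [[[i j] k] b].
have norm_le1 : `|coord_mx x i j k| ^+ 2 <= 1.
  rewrite -trho -xP raddf_sum /= (bigD1 i) //= {1}/mxtrace (bigD1 k) //=.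
  rewrite gram_diagE (bigD1 j) //= -!addrA lerDl !addr_ge0 //.
  - by rewrite sumr_ge0 // => l _; rewrite exprn_ge0.
  - by rewrite sumr_ge0 // => l _; apply/psd_diag_ge0/psd_gram.
  - by rewrite sumr_ge0 // => l _; apply/psd_trace_ge0/psd_gram.
have {norm_le1} : x (i, j, k, false) ^+ 2 + x (i, j, k, true) ^+ 2 <= 1.
  move: norm_le1; rewrite mxE -lecR; congr (_ <= _).
  by rewrite -add_Re2_Im2.
move=> le1; rewrite /= in_itv /= -ler_norml -(@expr_le1 _ 2) //.
rewrite real_normK ?num_real //; apply: le_trans le1.
by case: b; rewrite ?lerDl ?lerDr sqr_ge0.
Qed.

End Coordinates.

Lemma is_maximum_sup (A : set R) m : is_maximum A m -> sup A = m.
Proof.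
move=> [Am ubA]; apply/eqP; rewrite eq_le; apply/andP; split.
  by apply: ge_sup => //; exists m.
by apply: ub_le_sup => //; exists m.
Qed.

(** The extreme value theorem applies on the compact set of Gram factors, and by [psd_gramP] every
    decomposition comes from such factors. *)
Lemma guess_values_maximum d (I : finType) (rho : 'M[C]_d)
    (M : I -> 'M[C]_d) : quantum_state rho -> projective_measurement M ->
  is_maximum (guess_values rho M) (Pguess rho M).
Proof.
move=> hrho hM; have [prho _] := hrho.
suff [m mP] : exists m, is_maximum (guess_values rho M) m.
  by rewrite /Pguess (is_maximum_sup mP).
pose v (x : coord_space d I) :=
  \sum_i \tr (M i *m ((coord_mx x i)^t* *m coord_mx x i)).
have v_cont : ccontinuous v.
  apply: ccontinuous_sum => i; apply: ccontinuous_sum => j.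
  apply: (@eq_ccontinuous _ (fun x => \sum_k
    M i j k * ((coord_mx x i)^t* *m coord_mx x i) k j)) => [x|].
    by rewrite [RHS]mxE.
  apply: ccontinuous_sum => k.
  by apply: ccontinuousM; [exact: ccontinuous_cst|exact: ccontinuous_gram].
(* Traces of products of two positive semidefinite matrices are real, so passing to real parts loses
   nothing. *)
have v_real x : (complex.Re (v x))%:C = v x.
  apply: RRe_real; apply: ger0_real; rewrite sumr_ge0 // => i _.
  by apply: tr_psd_mul_ge0; [case: hM|exact: psd_gram].
have gramP r : state_decomposition rho r -> exists2 x : coord_space d I,
    gram_decompositions rho x &
    forall i, r i = (coord_mx x i)^t* *m coord_mx x i.
  move=> [pr rE]; have /choice[X XE] := fun i => psd_gramP (pr i).
  exists (mx_coord X); rewrite /gram_decompositions /= mx_coordK //.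
  by rewrite -rE; apply: eq_bigr.
(* The extreme value theorem needs a nonempty set; the pinched decomposition supplies a point. *)
have [x0 x0P _] := gramP _ (pinched_decomposition prho hM).
have [||x /set_mem xP x_max] := compact_EVT_max (A := gram_decompositions rho)
    (f := fun x => complex.Re (v x) : R) (ex_intro _ x0 x0P).
- exact: compact_gram_decompositions.
- exact/continuous_subspaceT/v_cont.1.
exists (complex.Re (v x)); split.
  exists (fun i => (coord_mx x i)^t* *m coord_mx x i); last exact: v_real.
  by split=> [i|]; [exact: psd_gram|exact: xP].
move=> p [r /gramP[y yP rE]].
rewrite (eq_bigr _ (fun i _ => congr1 (fun A => \tr (M i *m A)) (rE i))).
rewrite -/(v y) -v_real => -[->].
exact/x_max/mem_set.
Qed.

End Attainment.

(** * Matching the two bounds *)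

Theorem theorem1 (R : realType) (d : nat) (rho : 'M[R[i]]_d)
    (hrho : quantum_state rho) :
  [/\ forall (I : finType) (M : I -> 'M[R[i]]_d), projective_measurement M ->
        is_maximum (guess_values rho M) (Pguess rho M),
      is_minimum (Pguess_values rho) (Pguess_star rho),
      (Pguess_star rho)%:C = (\tr (sqrtmx rho)) ^+ 2 / d%:R
    & Hmin_star rho = - log2 (complex.Re ((\tr (sqrtmx rho)) ^+ 2 / d%:R))].
Proof.
have [prho _] := hrho; have [pS _] := sqrtmxP prho.
set t2d := _ / d%:R; set c := complex.Re t2d.
have t2d_ge0 : 0 <= t2d.
  by rewrite divr_ge0 ?exprn_ge0 ?psd_trace_ge0 ?ler0n.
have cE : c%:C = t2d by apply/RRe_real/ger0_real.
have maxP := guess_values_maximum hrho.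
have ge_c : lbound (Pguess_values rho) c.
  move=> _ [I [M [hM ->]]]; have [_ ub] := maxP I M hM.
  have := pinched_decomposition_ge prho hM; rewrite -/t2d.
  set v := (X in _ <= X) => t2d_le.
  have vE : (complex.Re v)%:C = v.
    exact/RRe_real/ger0_real/(le_trans t2d_ge0).
  apply: (@le_trans _ _ (complex.Re v)); first by rewrite -lecR cE vE.
  apply: ub; exists (fun i => sqrtmx rho *m M i *m sqrtmx rho) => //.
  exact: pinched_decomposition.
have [M hM M_le] := unbiased_measurement_le prho.
have Pc : Pguess rho M = c.
  apply/eqP; rewrite eq_le; apply/andP; split; last first.
    by apply: ge_c; exists _, M.
  (* Attainment matters here: [Pguess rho M] is the value of an actual decomposition [r], to which
     [M_le] applies. *)
  by have [[r /M_le le_r pE] _] := maxP _ _ hM; rewrite -lecR pE cE.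
have minc : is_minimum (Pguess_values rho) c.
  by split=> //; exists _, M.
have starE : Pguess_star rho = c.
  apply/eqP; rewrite eq_le; apply/andP; split.
    by apply: ge_inf; [exists c|exact: minc.1].
  by apply: lb_le_inf => //; exists c; exact: minc.1.
by split; rewrite ?starE // /Hmin_star starE.
Qed.
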